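(* Let $\mathbb{K}\subset\Theta$ be compact. Suppose that: $(\mathcal{A})$ there exist $\gamma>0$ and a function $B$ on $\mathbb{Z}$ of (at most) polynomial growth such that for all $h>0$, $n\in\mathbb{N}^*$, $l\in\mathbb{Z}$ and $\theta\in\mathbb{K}$, $$\mathbf{P}_\theta\Bigl(\Delta^{(M_1)}_h\bigl(Z_n^{1/2};[l,l+1]\bigr)>h^\gamma\Bigr)\leq B(l)\,h^\gamma;$$ $(\mathcal{B})$ there exists $\kappa>0$ such that $\mathbf{E}_\theta Z_n^{1/2}(u)\leq\exp\{-\kappa|u|\}$ for all $n\in\mathbb{N}^*$, $u\in\mathbb{R}$ and $\theta\in\mathbb{K}$. Then: (i) there exist $b,C>0$ such that for all $n\in\mathbb{N}^*$, $l\in\mathbb{Z}$ and $\theta\in\mathbb{K}$, $$\mathbf{P}_\theta\Bigl(\sup_{l\leq u\leq l+1}Z_n(u)>\exp\{-b|l|\}\Bigr)\leq C\exp\{-b|l|\};$$ (ii) there exist $b,C>0$ such that for all $n\in\mathbb{N}^*$, $A\in\mathbb{N}$ and $\theta\in\mathbb{K}$, $$\mathbf{P}_\theta\Bigl(\sup_{|u|>A}Z_n(u)>\exp\{-bA\}\Bigr)\leq C\exp\{-bA\};$$ (iii) for all $\varepsilon>0$, $$\lim_{h\to0}\ \limsup_{n\to+\infty}\ \sup_{\theta\in\mathbb{K}}\mathbf{P}_\theta\bigl(\Delta^{(M_1)}_h(Z_n)>\varepsilon\bigr)=0.$$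
   Context: $\mathbb{N}=\{0,1,2,\dots\}$, $\mathbb{N}^*=\{1,2,\dots\}$. $\mathcal{D}_0(\mathbb{R})$ is the space of càdlàg functions on $\mathbb{R}$ (right-continuous with left limits) vanishing at $\pm\infty$. Setting: $\Theta=(\alpha,\beta)\subset\mathbb{R}$. For each $n\in\mathbb{N}^*$ one observes $X^{(n)}$ with distribution $\mathbf{P}_\theta=\mathbf{P}_\theta^{(n)}$, $\theta\in\Theta$ ($\mathbf{E}_\theta$ is the corresponding expectation), having likelihood $L(\theta,X^{(n)})$ with respect to some reference measure. For a sequence $\varphi_n\searrow0$, the normalized likelihood ratio at the true value $\theta$ is $Z_n(u)=Z_n^{(\theta)}(u)=L(\theta+u\varphi_n,X^{(n)})/L(\theta,X^{(n)})$ for $u\in\mathbb{U}_n=(\varphi_n^{-1}(\alpha-\theta),\varphi_n^{-1}(\beta-\theta))$; it is extended to all $u\in\mathbb{R}$ in such a way that $Z_n$ is a nonnegative process with trajectories in $\mathcal{D}_0(\mathbb{R})$. For real $a,b,c$, $d(c;[a,b])$ is the distance between $c$ and the closed interval with endpoints $a$ and $b$ (that is, $[b,a]$ if $b<a$). For $f\in\mathcal{D}_0(\mathbb{R})$ and $h>0$, $$\Delta^{(M_1)}_h(f)=\sup_{u\in\mathbb{R}}\ \sup_{u',u''\in\mathbb{R}:\,u-h\leq u'\leq u\leq u''\leq u+h}d\bigl(f(u);[f(u'),f(u'')]\bigr)+\sup_{|u|>1/h}|f(u)|,$$ and for an interval $[A,B]\subset\mathbb{R}$, $$\Delta^{(M_1)}_h(f;[A,B])=\sup_{u\in[A,B]}\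 \sup_{u',u''\in\mathbb{R}:\,u-h\leq u'\leq u\leq u''\leq u+h}d\bigl(f(u);[f(u'),f(u'')]\bigr).$$ *)

(* Defs.v *)
From HB Require Import structures.
From mathcomp Require Import all_boot all_order all_algebra.
From mathcomp Require Import all_classical all_reals all_analysis.

Set Implicit Arguments.
Unset Strict Implicit.
Unset Printing Implicit Defensive.

Import Order.TTheory GRing.Theory Num.Theory.
Import numFieldNormedType.Exports.

Local Open Scope classical_set_scope.
Local Open Scope ring_scope.

Definition cadlag (R : realType) (f : R -> R) : Prop :=
  forall u : R, f v @[v --> u^'+] --> f u /\ cvg (f v @[v --> u^'-]).

Definition D0 (R : realType) (f : R -> R) : Prop :=
  [/\ cadlag f, f u @[u --> +oo] --> (0 : R) & f u @[u --> -oo] --> (0 : R)].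

Definition dist_seg (R : realType) (c a b : R) : R :=
  inf [set `|c - y| | y in [set y | Num.min a b <= y <= Num.max a b]].

(* All suprema of trajectories are taken in [\bar R], so that no boundedness
   has to be known for them to be meaningful. *)
Definition M1_osc (R : realType) (h : R) (f : R -> R) (D : set R) : \bar R :=
  ereal_sup [set ereal_sup
      [set (dist_seg (f u) (f p.1) (f p.2))%:E |
         p in [set p : R * R | u - h <= p.1 <= u /\ u <= p.2 <= u + h]]
    | u in D].

Definition Delta_M1 (R : realType) (h : R) (f : R -> R) : \bar R :=
  (M1_osc h f setT
   + ereal_sup [set `|f u|%:E | u in [set u : R | (1 / h < `|u|)%R]])%E.

(* Only the middle point [u] is confined to [A, B]; its neighbours [u'], [u'']
   may lie outside. *)
Definition Delta_M1_on (R : realType) (h : R) (f : R -> R) (A B : R) : \bar R :=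
  M1_osc h f [set u | A <= u <= B].

Definition poly_growth (R : realType) (B : int -> R) : Prop :=
  exists (C : R) (p : nat), forall l : int, `|B l| <= C * (1 + `|l%:~R|) ^+ p.

(* The endpoints may be infinite. *)
Definition param_space (R : realType) (alpha beta : \bar R) : set R :=
  [set t | (alpha < t%:E < beta)%E].

Definition local_param (R : realType) (alpha beta : \bar R) (phi theta : R) :
    set R :=
  [set u | (phi^-1%:E * (alpha - theta%:E) < u%:E
            < phi^-1%:E * (beta - theta%:E))%E].

Definition is_likelihood d (T : measurableType d) (R : realType)
    (nu : {measure set T -> \bar R}) (P : probability T R) (f : T -> R) : Prop :=
  [/\ measurable_fun setT f, forall x, 0 <= f x &
      forall A, measurable A -> P A = (\int[nu]_(x in A) (f x)%:E)%E].

(* [Z u x] is the normalized likelihood ratio at [theta] for the observation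
   [x], extended to all real [u].  The quotient is only imposed where its
   denominator is nonzero, which is almost sure under the true value [theta]. *)
Definition normalized_LR d (T : measurableType d) (R : realType)
    (alpha beta : \bar R) (L : R -> T -> R) (phi theta : R)
    (Z : R -> T -> R) : Prop :=
  [/\ forall u x, local_param alpha beta phi theta u -> L theta x != 0 ->
        Z u x = L (theta + u * phi) x / L theta x,
      forall u, measurable_fun setT (Z u),
      forall u x, 0 <= Z u x &
      forall x, D0 (Z ^~ x)].

(* Main.v *)
(* Write f = Z^(1/2). Between two neighbours of a grid of mesh at most h, the
   value of f exceeds the larger grid value by at most its M1-oscillation; so,
   on a unit interval, sup f <= s + h^gamma unless the oscillation exceeds
   h^gamma (hypothesis (A)) or f exceeds s at one of the O(1/h) grid points
   (Markov's inequality and (B)). Taking s = h^gamma and h a suitable multiple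
   of exp (- a |l|) with kappa - a (1 + gamma) = kappa / 2 gives (i), and
   summing over |l| >= A gives (ii). For (iii), (ii) disposes of |u| > A; for
   |u| <= A + 1 the same bound with h fixed and s large makes f <= M with high
   probability, and there the oscillation of Z = f^2 is at most 2 M times
   that of f, that is, at most 2 M h^gamma, for small h.

   The measure of a non-measurable set is arbitrary in MathComp-Analysis, so the
   events involved are first shown to be measurable, by reducing the suprema to
   countable index sets via right-continuity. *)
Require Import Defs.
From HB Require Import structures.
From mathcomp Require Import all_boot all_order all_algebra.
From mathcomp Require Import all_classical all_reals all_analysis.
From mathcomp Require Import measurable_realfun lra ring.

Set Implicit Arguments.
Unset Strict Implicit.
Unset Printing Implicit Defensive.

Import Order.TTheory GRing.Theory Num.Theory.
Import numFieldNormedType.Exports.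

Local Open Scope classical_set_scope.
Local Open Scope ring_scope.

(** * Distance from a point to a segment *)

Section DistSeg.
Variable R : realType.
Implicit Types a b c t : R.

(** The nearest point of the segment is one of its ends or [c] itself. The closed form makes the
    distance visibly measurable in its arguments. *)
Lemma dist_segE c a b :
  dist_seg c a b =
  Num.max 0 (Num.max (Num.min a b - c) (c - Num.max a b)).
Proof.
have mM : Num.min a b <= Num.max a b by rewrite ge_min !le_max !lexx.
rewrite /dist_seg; move: (Num.min a b) (Num.max a b) mM => m M mM.
set S := (X in inf X); set r := (RHS).
have lbr : lbound S r.
  move=> _ [y /= /andP[my yM] <-].
  rewrite /r !ge_max normr_ge0 /=; apply/andP; split.
    by rewrite distrC (le_trans _ (ler_norm _))// lerB.
  by rewrite (le_trans _ (ler_norm _))// lerB.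
have Sr : S r.
  rewrite /S /r; have [cm|mc] := leP c m.
    exists m; first by rewrite /= lexx.
    rewrite ler0_norm ?subr_le0// opprB.
    have -> : Num.max (m - c) (c - M) = m - c by apply/max_idPl; lra.
    by apply/esym/max_idPr; rewrite subr_ge0.
  have [Mc|cM] := leP M c.
    exists M; first by rewrite /= lexx mM.
    rewrite ger0_norm ?subr_ge0//.
    have -> : Num.max (m - c) (c - M) = c - M by apply/max_idPr; lra.
    by apply/esym/max_idPr; rewrite subr_ge0.
  exists c; first by rewrite /= !ltW.
  rewrite subrr normr0; apply/esym/max_idPl; rewrite ge_max !subr_le0.
  by rewrite !ltW.
apply/eqP; rewrite eq_le; apply/andP; split.
  by apply: ge_inf => //; exists r.
by apply: lb_le_inf => //; exists r.
Qed.

(** The point lies at most [t] below the lower end and at most [t] above the upper end. Written with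
    disjunctions, this leaves only linear inequalities in each case. *)
Lemma dist_seg_leP c a b t : 0 <= t ->
  dist_seg c a b <= t <->
  (a <= c + t \/ b <= c + t) /\ (c <= a + t \/ c <= b + t).
Proof.
move=> t0; rewrite dist_segE !ge_max t0 /=.
have -> : (Num.min a b - c <= t) = (a <= c + t) || (b <= c + t).
  by rewrite lerBlDr ge_min [t + c]addrC.
have -> : (c - Num.max a b <= t) = (c <= a + t) || (c <= b + t).
  by rewrite lerBlDl -lerBlDr le_max !lerBlDr.
by split=> [/andP[/orP ? /orP ?]|[? ?]] //; apply/andP; split; apply/orP.
Qed.

Lemma dist_seg_ge0 c a b : 0 <= dist_seg c a b.
Proof. by rewrite dist_segE le_max lexx. Qed.

Lemma dist_seg_lipschitz c a b c' a' b' e :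
  `|c - c'| < e -> `|a - a'| < e -> `|b - b'| < e ->
  dist_seg c a b <= dist_seg c' a' b' + e *+ 2.
Proof.
move=> /ltr_normlP[c1 c2] /ltr_normlP[a1 a2] /ltr_normlP[b1 b2].
have e0 : 0 <= e by lra.
have t0 := dist_seg_ge0 c' a' b'.
have /(dist_seg_leP _ _ _ t0) := lexx (dist_seg c' a' b').
move: (dist_seg c' a' b') t0 => t t0 [h1 h2].
apply/dist_seg_leP; first lra.
split; first by case: h1 => h; [left|right]; lra.
by case: h2 => h; [left|right]; lra.
Qed.

(** The end [a] belongs to the segment and is within [M] of [c], both being in [[0, M]]. This serves
    far from the origin, where trajectories are small. *)
Lemma dist_seg_le_max c a b M : 0 <= a -> 0 <= c <= M -> a <= M ->
  dist_seg c a b <= M.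
Proof.
move=> a0 /andP[c0 cM] aM; apply/dist_seg_leP; first lra.
by split; left; lra.
Qed.

(** Squaring is increasing and 2M-Lipschitz on [[0, M]]; this carries oscillation bounds from
    Z^(1/2) to Z. *)
Lemma dist_seg_sqr c a b M : 0 <= c <= M -> 0 <= a <= M -> 0 <= b <= M ->
  dist_seg (c ^+ 2) (a ^+ 2) (b ^+ 2) <= M *+ 2 * dist_seg c a b.
Proof.
move=> /andP[c0 cM] /andP[a0 aM] /andP[b0 bM].
have t0 := dist_seg_ge0 c a b.
have /(dist_seg_leP _ _ _ t0) := lexx (dist_seg c a b).
move: (dist_seg c a b) t0 => t t0 [h1 h2].
apply/dist_seg_leP; first by apply: mulr_ge0 => //; lra.
(* u^2 - v^2 = (u - v) (u + v) <= 2 M t when u - v <= t *)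
have key u v : 0 <= u <= M -> 0 <= v <= M -> u <= v + t ->
    u ^+ 2 <= v ^+ 2 + M *+ 2 * t.
  move=> /andP[u0 uM] /andP[v0 vM] uv.
  have [uv'|vu] := leP u v.
    by rewrite (le_trans (_ : _ <= v ^+ 2)) ?ler_sqr ?lerDl ?mulr_ge0//; lra.
  by nra.
split; first by case: h1 => h; [left|right]; apply: key; rewrite ?c0 ?a0 ?b0.
by case: h2 => h; [left|right]; apply: key; rewrite ?c0 ?a0 ?b0.
Qed.

End DistSeg.

(** * Right-continuity and measurability of the events *)

Definition right_continuous (R : realType) (f : R -> R) : Prop :=
  forall u, f v @[v --> u^'+] --> f u.

Lemma right_continuousP (R : realType) (f : R -> R) (u e : R) :
  right_continuous f -> 0 < e ->
  exists2 r, 0 < r & forall v, u <= v < u + r -> `|f u - f v| < e.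
Proof.
move=> /(_ u) /cvgrPdist_lt /(_ e) fu e0; have := fu e0.
case=> r /= r0 hr; exists r => // v /andP[].
rewrite le_eqVlt => /orP[/eqP <- _|uv vr]; first by rewrite subrr normr0.
by apply: hr => //=; rewrite ltr0_norm ?subr_lt0//; lra.
Qed.

Section Measurability.
Context d (T : measurableType d) (R : realType).
(** The condition under which right-continuity reduces a supremum over [D] to the rationals of [D]
    and the point [b]. It covers closed segments, whose right end is the exception, as well as open
    sets. *)
Definition right_open_but (b : R) (D : set R) :=
  forall u, D u -> u = b \/
    exists2 r, 0 < r & forall v, u <= v < u + r -> D v.

Lemma right_open_but_seg (a b : R) : right_open_but b [set u | a <= u <= b].
Proof.
move=> u /= /andP[au]; rewrite le_eqVlt => /orP[/eqP|ub]; first by left.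
by right; exists (b - u); rewrite ?subr_gt0// => v; lra.
Qed.

Lemma right_open_but_norm_gt (a b : R) : right_open_but b [set u | a < `|u|].
Proof.
move=> u /=; rewrite lter_normr => /orP[au|au]; right.
  exists 1 => // v /andP[uv _]; rewrite /= lter_normr; apply/orP; left.
  exact: lt_le_trans uv.
exists (- u - a); first by rewrite subr_gt0.
by move=> v vu; rewrite /= lter_normr; apply/orP; right; lra.
Qed.

Lemma bigcup_countType_measurable (I : countType) (D : I -> Prop)
    (F : I -> set T) : (forall i, measurable (F i)) ->
  measurable (\bigcup_(i in D) F i).
Proof.
move=> mF; rewrite bigcup_mkcond; apply: countable_bigcupT_measurable.
  exact: countableP.
by move=> i; case: ifPn.
Qed.

Lemma measurable_gt (g : T -> R) (c : R) : measurable_fun setT g ->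
  measurable [set x | c < g x].
Proof.
move=> mg; have := measurable_fun_ltr (measurable_cst c) mg.
by move=> /(_ measurableT [set true]); rewrite setTI; exact.
Qed.

Lemma measurable_fun_ereal_gt (g : T -> \bar R) :
  (forall c : R, measurable [set x | (c%:E < g x)%E]) -> measurable_fun setT g.
Proof.
move=> mg mT; apply: (measurability _ (ErealGenOInfty.measurableE R)) => //.
move=> _ [_ [c ->] <-]; rewrite setTI [X in measurable X](_ : _ =
  [set x | (c%:E < g x)%E])//.
by apply/seteqP; split => x /=; rewrite in_itv /= andbT.
Qed.

Variable f : R -> T -> R.
Hypothesis fm : forall u, measurable_fun setT (f u).
Hypothesis fr : forall x, right_continuous (f ^~ x).

(** A value above [c] at [u] persists just to the right of [u], hence at a rational of [D] unless
    [u = b]. The index [None] codes [b]. *)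
Lemma measurable_sup_gt (D : set R) (b c : R) :
  right_open_but b D ->
  measurable [set x | (c%:E < ereal_sup [set (f u x)%:E | u in D])%E].
Proof.
move=> hD.
pose s (i : option rat) : R := if i is Some q then ratr q else b.
rewrite [X in measurable X](_ : _ =
    \bigcup_(i in [set i | D (s i)]) [set x | c < f (s i) x]).
  apply: bigcup_countType_measurable => i.
  exact: measurable_gt.
apply/seteqP; split => x /=.
  move=> /ereal_sup_gt[_ [u Du <-]]; rewrite lte_fin => cu.
  have [ub|[r r0 hr]] := hD u Du; first by exists None; rewrite /= -?ub.
  have [|e e0 he] := @right_continuousP _ (f ^~ x) u (f u x - c) (@fr x).
    by rewrite subr_gt0.
  have /rat_in_itvoo[q] : u < u + Num.min r e by rewrite ltrDl lt_min r0.
  rewrite in_itv /= -ltrBlDl lt_min => /and3P[uq qr qe].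
  exists (Some q) => /=; first by apply: hr; lra.
  have /he /ltr_normlP[_] : u <= ratr q < u + e by lra.
  lra.
move=> [i /= Di ci]; apply: lt_le_trans (_ : ((f (s i) x)%:E <= _)%E).
  by rewrite lte_fin.
by apply: ereal_sup_ubound; exists (s i).
Qed.

Lemma measurable_M1_osc_gt (D : set R) (b h c : R) : 0 < h ->
  right_open_but b D ->
  measurable [set x | (c%:E < M1_osc h (f ^~ x) D)%E].
Proof.
move=> h0 hD.
(* Besides the rationals, [b] and [b + h] are needed: when the middle point is stuck at [b], a
   neighbour equal to [b] or [b + h] cannot be moved to the right either. *)
pose s (i : option (option rat)) : R :=
  if i is Some j then (if j is Some q then ratr q else b + h) else b.
pose ok (u u' u'' : R) := D u /\ u - h <= u' <= u /\ u <= u'' <= u + h.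
have ratI (y z : R) : y < z -> exists q, y < s (Some (Some q)) < z.
  by move=> /rat_in_itvoo[q]; rewrite in_itv /=; exists q.
(* every admissible triple is a limit from the right of admissible triples
   with entries in the countable range of [s] *)
have approx u u' u'' e : 0 < e -> ok u u' u'' ->
    exists i i' i'', [/\ ok (s i) (s i') (s i''), u <= s i < u + e,
      u' <= s i' < u' + e & u'' <= s i'' < u'' + e].
  move=> e0 [Du [/andP[h1 h2] /andP[h3 h4]]].
  have [ub|[r r0 hr]] := hD u Du.
    have [i' [hi1 hi2]] : exists i', u' <= s i' < u' + e /\ s i' <= u.
      have [u'u|uu'] := ltP u' u.
        have /ratI[q] : u' < Num.min u (u' + e) by rewrite lt_min u'u ltrDl.
        by rewrite lt_min => /and3P[? ? ?]; exists (Some (Some q)); split; lra.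
      by exists None; rewrite /= -ub; split; lra.
    have [i'' [hi3 hi4]] : exists i'', u'' <= s i'' < u'' + e /\ s i'' <= u + h.
      have [uu|uu] := ltP u'' (u + h).
        have /ratI[q] : u'' < Num.min (u + h) (u'' + e).
          by rewrite lt_min uu ltrDl.
        by rewrite lt_min => /and3P[? ? ?]; exists (Some (Some q)); split; lra.
      by exists (Some None); rewrite /= -ub; split; lra.
    exists None, i', i''; split => //=; last by rewrite -ub; lra.
    by rewrite /ok /= -ub; split => //; split; lra.
  (* Here [u] itself moves right to a rational; the windows allowed for the two neighbours move with
     it, which leaves room to the right of [u'] and of [u'']. *)
  have /ratI[q] : u < u + Num.min r e by rewrite ltrDl lt_min r0.
  rewrite -ltrBlDl lt_min => /and3P[uq qr qe].
  move: (Some (Some q)) uq qr qe => i uq qr qe.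
  have /ratI[q'] : Num.max u' (s i - h) < Num.min (s i) (u' + e).
    by rewrite lt_min !gt_max; apply/andP; split; apply/andP; split; lra.
  rewrite lt_min gt_max => /andP[/andP[? ?] /andP[? ?]].
  have /ratI[q''] : Num.max u'' (s i) < Num.min (s i + h) (u'' + e).
    by rewrite lt_min !gt_max; apply/andP; split; apply/andP; split; lra.
  rewrite lt_min gt_max => /andP[/andP[? ?] /andP[? ?]].
  exists i, (Some (Some q')), (Some (Some q'')); split; try lra.
  by split; [apply: hr; lra|split; lra].
rewrite [X in measurable X](_ : _ =
    \bigcup_(i in [set i : _ * _ * _ | ok (s i.1.1) (s i.1.2) (s i.2)])
      [set x | c < dist_seg (f (s i.1.1) x) (f (s i.1.2) x) (f (s i.2) x)]).
  apply: bigcup_countType_measurable => -[[i i'] i''] /=.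
  under eq_set do rewrite dist_segE.
  apply: measurable_gt.
  apply: measurable_maxr => //; apply: measurable_maxr.
      by apply: measurable_funB => //; apply: measurable_minr.
    by apply: measurable_funB => //; apply: measurable_maxr.
apply/seteqP; split => x /=.
  move=> /ereal_sup_gt[_ [u Du <-]] /ereal_sup_gt[_ [[u' u''] /= [h1 h2] <-]].
  rewrite lte_fin => cd.
  set D0 := dist_seg _ _ _ in cd.
  (* Perturbing the three values by less than a third of the gap costs at most two thirds of it, so
     the distance stays above [c]. *)
  have e0 : 0 < (D0 - c) / 3 by rewrite divr_gt0// subr_gt0.
  have [r1 r10 hr1] := right_continuousP u (@fr x) e0.
  have [r2 r20 hr2] := right_continuousP u' (@fr x) e0.
  have [r3 r30 hr3] := right_continuousP u'' (@fr x) e0.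
  have [||i [i' [i'' [hok a1 a2 a3]]]] :=
    approx u u' u'' (Num.min r1 (Num.min r2 r3)).
  - by rewrite !lt_min r10 r20.
  - by [].
  exists (i, i', i'') => //=.
  have lt3 y z : y <= z < y + Num.min r1 (Num.min r2 r3) ->
      [/\ y <= z < y + r1, y <= z < y + r2 & y <= z < y + r3].
    rewrite -ltrBlDl !lt_min => /andP[? /and3P[? ? ?]].
    by split; lra.
  have /lt3[/hr1 b1 _ _] := a1; have /lt3[_ /hr2 b2 _] := a2.
  have /lt3[_ _ /hr3 b3] := a3.
  have := dist_seg_lipschitz b1 b2 b3.
  rewrite -/D0; lra.
move=> [[[i i'] i''] /= [Di [h1 h2]] ci].
apply: lt_le_trans (_ : ((dist_seg (f (s i) x) (f (s i') x) (f (s i'') x))%:E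
  <= _)%E); first by rewrite lte_fin.
apply: le_trans (_ : (_ <= ereal_sup _)%E) _; last first.
  by apply: ereal_sup_ubound; exists (s i).
by apply: ereal_sup_ubound; exists (s i', s i'').
Qed.

Lemma measurable_Delta_M1_gt (h c : R) : 0 < h ->
  (forall u x, 0 <= f u x) ->
  measurable [set x | (c%:E < Delta_M1 h (f ^~ x))%E].
Proof.
move=> h0 f0; rewrite -[X in measurable X]setTI.
apply: emeasurable_fun_o_infty => //; apply: emeasurable_funD.
  apply: measurable_fun_ereal_gt => t.
  apply: (@measurable_M1_osc_gt _ 0) => // u _; right.
  by exists 1.
apply: measurable_fun_ereal_gt => t.
rewrite [X in measurable X](_ : _ = [set x | (t%:E < ereal_sup
    [set (f u x)%:E | u in [set u : R | (1 / h < `|u|)%R]])%E]).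
  exact: (measurable_sup_gt _ (@right_open_but_norm_gt _ 0)).
apply/seteqP; split => x /=; rewrite (@eq_imagel _ _ _ (fun u => `|f u x|%:E)
  (fun u => (f u x)%:E))// => u _; rewrite ger0_norm//.
Qed.

End Measurability.

(** * Supremum over a unit interval from grid values *)

Lemma M1_osc_ge (R : realType) (g : R -> R) (D : set R) (h u u' u'' : R) :
  D u -> u - h <= u' <= u -> u <= u'' <= u + h ->
  ((dist_seg (g u) (g u') (g u''))%:E <= M1_osc h g D)%E.
Proof.
move=> Du h1 h2; apply: le_trans (_ : (_ <= ereal_sup _)%E) _; last first.
  by apply: ereal_sup_ubound; exists u.
by apply: ereal_sup_ubound; exists (u', u'').
Qed.

Lemma ereal_sup_le_M1_osc (R : realType) (g : R -> R) (l h s t : R) (m : nat) :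
  (0 < m)%N -> m%:R^-1 <= h -> (Delta_M1_on h g l (l + 1) <= t%:E)%E ->
  (forall i, (i <= m)%N -> g (l + i%:R / m%:R) <= s) ->
  (ereal_sup [set (g u)%:E | u in [set u | (l <= u <= l + 1)%R]]
     <= (s + t)%:E)%E.
Proof.
move=> m0 mh ht hs; apply: ge_ereal_sup => _ [u /= lu <-].
have mR0 : 0 < m%:R :> R by rewrite ltr0n.
have bound u' u'' : u - h <= u' <= u -> u <= u'' <= u + h ->
    g u' <= s -> g u'' <= s -> g u <= s + t.
  move=> h1 h2 s1 s2.
  have := le_trans (M1_osc_ge g (D := [set u | l <= u <= l + 1]) lu h1 h2) ht.
  rewrite lee_fin => dt; have t0 := le_trans (dist_seg_ge0 _ _ _) dt.
  by have /(dist_seg_leP _ _ _ t0)[_ [?|?]] := dt; lra.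
rewrite lee_fin.
have lu0 : 0 <= (u - l) * m%:R by apply: mulr_ge0; lra.
have /andP[i1 i2] := truncn_itv lu0; set i := Num.trunc _ in i1 i2.
have h0 : 0 < h by apply: lt_le_trans mh; rewrite invr_gt0.
(* The right end [l + 1] is the last grid point and has no successor in the grid; there both
   neighbours are taken equal to [u]. *)
have [im|mi] := ltnP i m; last first.
  have ul : u = l + 1.
    apply/eqP; rewrite eq_le; apply/andP; split; first lra.
    have : m%:R <= (u - l) * m%:R by apply: le_trans i1; rewrite ler_nat.
    by rewrite ler_pMl// => ?; lra.
  have gs : g u <= s by rewrite ul -{1}(@divff _ m%:R) ?gt_eqF//; exact: hs.
  by apply: (bound u u) => //; lra.
have : i%:R / m%:R <= u - l by rewrite ler_pdivrMr.
have : u - l <= i.+1%:R / m%:R by rewrite ler_pdivlMr// ltW.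
have : i.+1%:R / m%:R = i%:R / m%:R + m%:R^-1 :> R.
  by rewrite -natr1 mulrDl mul1r.
move=> im1 ui iu; apply: (bound (l + i%:R / m%:R) (l + i.+1%:R / m%:R)).
- lra.
- lra.
- exact/hs/ltnW.
- exact: hs.
Qed.

(** * Markov's inequality and the union bound over the grid *)

Section Tail.
Context d (T : measurableType d) (R : realType) (P : probability T R).

Lemma le_probability_expectation (X : T -> R) (s e : R) :
  measurable_fun setT X -> (forall x, 0 <= X x) -> 0 < s ->
  ('E_P[X] <= e%:E)%E -> (P [set x | (s < X x)%R] <= (e / s)%:E)%E.
Proof.
move=> mX X0 s0; rewrite unlock => Xe.
have mXE : measurable_fun setT (EFin \o X) by exact/measurable_EFinP.
have := le_integral_abse P measurableT mXE s0.
rewrite setTI => sP.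
have mle : measurable [set x | (s%:E <= `|(EFin \o X) x|)%E].
  rewrite -[X in measurable X]setTI; apply: emeasurable_fun_c_infty => //.
  exact: measurableT_comp.
apply: (@le_trans _ _ (P [set x | (s%:E <= `|(EFin \o X) x|)%E])).
  apply: le_measure; rewrite ?inE//; first exact: measurable_gt.
  by move=> x /= sX; rewrite lee_fin ger0_norm// ltW.
rewrite mulrC EFinM lee_pdivlMl//; apply: le_trans sP _.
apply: le_trans Xe; rewrite le_eqVlt; apply/orP; left; apply/eqP.
by apply: eq_integral => x _ /=; rewrite ger0_norm.
Qed.

Variable f : R -> T -> R.
Hypothesis fm : forall u, measurable_fun setT (f u).
Hypothesis fr : forall x, right_continuous (f ^~ x).
Hypothesis f0 : forall u x, 0 <= f u x.

(** Off the oscillation event, a supremum above [s + t] forces a value above [s] at one of the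
    [m + 1] grid points, each of probability at most [e / s]. *)
Lemma probability_sup_gt (l h s t e : R) (m : nat) :
  (0 < m)%N -> m%:R^-1 <= h -> 0 < s ->
  (forall u, l <= u <= l + 1 -> ('E_P[f u] <= e%:E)%E) ->
  (P [set x | (s + t)%:E <
        ereal_sup [set (f u x)%:E | u in [set u | (l <= u <= l + 1)%R]]]
   <= P [set x | t%:E < Delta_M1_on h (f ^~ x) l (l + 1)]
      + (m.+1%:R * (e / s))%:E)%E.
Proof.
move=> m0 mh s0 Ee.
have mR0 : 0 < m%:R :> R by rewrite ltr0n.
have h0 : 0 < h by apply: lt_le_trans mh; rewrite invr_gt0.
set E := (X in (P X <= _)%E); set O := (X in (_ <= P X + _)%E).
pose F i := [set x | s < f (l + i%:R / m%:R) x].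
have mF i : measurable (F i) by exact: measurable_gt.
have mU : measurable (\big[setU/set0]_(i < m.+1) F i).
  by apply: bigsetU_measurable.
have mO : measurable O.
  exact: (measurable_M1_osc_gt fm fr _ h0 (@right_open_but_seg _ _ _)).
have mE : measurable E.
  exact: (measurable_sup_gt fm fr _ (@right_open_but_seg _ _ _)).
have EOU : E `<=` O `|` \big[setU/set0]_(i < m.+1) F i.
  move=> x Ex; apply: contrapT => /not_orP[/negP Ox Ux]; move: Ex.
  apply/negP; rewrite -leNgt; rewrite -leNgt in Ox.
  apply: (ereal_sup_le_M1_osc m0 mh) => // i im.
  rewrite leNgt; apply/negP => Fix; apply: Ux.
  by rewrite -bigcup_mkord; exists i.
apply: le_trans (le_measure P _ _ EOU) _; rewrite ?inE//.
  exact: measurableU.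
apply: le_trans (measureU2 _ mO mU) _; rewrite leeD2l//.
have := @content_subadditive _ _ _ P _ F m.+1 (fun k _ => mF k) mU.
move=> /(_ (@subset_refl _ _)) /le_trans; apply.
apply: le_trans (lee_sum (g := fun=> (e / s)%:E) _ _) _.
  move=> i _; apply: le_probability_expectation => //; apply: Ee.
  rewrite lerDl lerD2l divr_ge0//= ler_pdivrMr// mul1r ler_nat -ltnS.
  exact: ltn_ord.
by rewrite sumEFin sumr_const card_ord mulr_natl.
Qed.

End Tail.

(** * Elementary estimates and the deterministic bound on the modulus *)

Section RealBounds.
Variable R : realType.
Implicit Types x y e t : R.

(** One has [1 + x <= k (1 + t x) <= k exp (t x)]; the power [p] is then taken. Dividing by [p + 1]
    ensures [p t <= e] and allows [p = 0]. *)
Lemma exprn_le_expR (p : nat) e : 0 < e ->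
  exists2 M : R, 0 < M & forall x, 0 <= x -> (1 + x) ^+ p <= M * expR (e * x).
Proof.
move=> e0; pose t := e / p.+1%:R; pose k := 1 + t^-1.
have t0 : 0 < t by rewrite divr_gt0.
have k0 : 0 < k by rewrite addr_gt0// invr_gt0.
exists (k ^+ p); first exact: exprn_gt0.
move=> x x0; apply: (@le_trans _ _ ((k * expR (t * x)) ^+ p)).
  apply: lerXn2r; rewrite ?nnegrE ?addr_ge0 ?mulr_ge0 ?expR_ge0 ?(ltW k0)//.
  apply: le_trans (_ : k * (1 + t * x) <= _); last first.
    by rewrite ler_pM2l// expR_ge1Dx.
  have -> : k * (1 + t * x) = 1 + t^-1 + t * x + x.
    by rewrite /k; field; rewrite gt_eqF.
  have : 0 <= t^-1 by rewrite invr_ge0 ltW.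
  have : 0 <= t * x by rewrite mulr_ge0// ltW.
  by lra.
rewrite exprMn -expRM_natl ler_pM2l ?exprn_gt0// ler_expR mulrA ler_wpM2r//.
by rewrite /t mulrCA ler_piMr ?(ltW e0)// ler_pdivrMr// mul1r ler_nat.
Qed.

Lemma expRN_le_near_infty (b e : R) : 0 < b -> 0 < e ->
  exists A : nat, expR (- (b * A%:R)) <= e.
Proof.
move=> b0 e0; exists (Num.trunc (b^-1 * e^-1)).+1.
rewrite expRN -[leRHS]invrK lef_pV2 ?posrE ?expR_gt0 ?invr_gt0//.
apply: le_trans (expR_ge1Dx _); apply: ler_wpDl => //.
by rewrite -ler_pdivrMl// ltW// truncnS_gt.
Qed.

Lemma powR_le_near0 (g e : R) : 0 < g -> 0 < e ->
  exists h0 : R, [/\ 0 < h0, h0 <= 1 & forall h, 0 < h <= h0 -> h `^ g <= e].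
Proof.
move=> g0 e0; exists (Num.min 1 (e `^ g^-1)).
rewrite lt_min ltr01 powR_gt0// ge_min lexx; split => // h /andP[h0].
rewrite le_min => /andP[_ he].
have -> : e = (e `^ g^-1) `^ g by rewrite -powRrM mulVf ?gt_eqF// powRr1// ltW.
by apply: ge0_ler_powR; rewrite ?nnegrE ?powR_ge0// ltW.
Qed.

Lemma expRN_norm_le (k l u : R) : 0 < k -> l <= u <= l + 1 ->
  expR (- (k * `|u|)) <= expR k * expR (- (k * `|l|)).
Proof.
move=> k0 lu; rewrite -expRD ler_expR.
have : `|l| <= `|u| + 1.
  have -> : l = u - (u - l) by lra.
  rewrite (le_trans (ler_normB _ _))// lerD2l ger0_norm; lra.
nra.
Qed.

(** One [r] bounds the oscillation and the other the tail beyond [1 / h]. The central zone reaches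
    [A + 1] so that, as [h <= 1], neighbours of a point outside it are still beyond [A]. *)
Lemma Delta_M1_le_sqrt (g : R -> R) (h r M t : R) (A : nat) :
  (forall u, 0 <= g u) -> h <= 1 -> A%:R <= 1 / h ->
  0 <= r <= 1 -> 1 <= M -> M *+ 2 * t <= r ->
  (forall u, A%:R < `|u| -> g u <= r) ->
  (forall u, `|u| <= A%:R + 1 -> Num.sqrt (g u) <= M) ->
  (forall u u' u'', `|u| <= A%:R + 1 -> u - h <= u' <= u -> u <= u'' <= u + h ->
     dist_seg (Num.sqrt (g u)) (Num.sqrt (g u')) (Num.sqrt (g u'')) <= t) ->
  (Delta_M1 h g <= (r *+ 2)%:E)%E.
Proof.
move=> g0 h1 Ah /andP[r0 r1] M1 Mt gr gM gt.
(* The bound is needed on the whole line, since neighbours of a central point may leave the central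
   zone; out there [g <= r <= 1 <= M]. *)
have sM u : 0 <= Num.sqrt (g u) <= M.
  rewrite sqrtr_ge0 /=; have [/gM//|uA] := leP `|u| (A%:R + 1).
  apply: le_trans M1; rewrite -sqrtr1 ler_wsqrtr//.
  by apply: le_trans r1; apply: gr; apply: lt_trans uA; rewrite ltrDl.
rewrite mulr2n EFinD; apply: leeD; last first.
  apply: ge_ereal_sup => _ [u /= hu <-]; rewrite lee_fin ger0_norm// gr//.
  exact: le_lt_trans hu.
apply: ge_ereal_sup => _ [u _ <-].
apply: ge_ereal_sup => _ [[u' u''] /= [h2 h3] <-].
rewrite lee_fin; have [uA|uA] := leP `|u| (A%:R + 1).
  rewrite -(sqr_sqrtr (g0 u)) -(sqr_sqrtr (g0 u')) -(sqr_sqrtr (g0 u'')).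
  apply: le_trans (dist_seg_sqr _ _ _) _ => //.
  by apply: le_trans Mt; rewrite ler_wpM2l ?gt//; lra.
apply: dist_seg_le_max => //; rewrite ?g0 ?gr//.
  by apply: lt_trans uA; rewrite ltrDl.
have : `|u| <= `|u'| + 1; last lra.
have -> : u = u' + (u - u') by lra.
rewrite (le_trans (ler_normD _ _))// lerD2l ger0_norm; lra.
Qed.

End RealBounds.

(** * Estimates uniform over a family of processes *)

Section UniformFamily.
Context (R : realType) (I : Type) (d : I -> measure_display).
Context (T : forall i, measurableType (d i)).
Variable P : forall i, probability (T i) R.
Variable Z : forall i, R -> T i -> R.
Arguments Z : clear implicits.
Hypothesis Zm : forall i u, measurable_fun setT (Z i u).
Hypothesis Zr : forall i x, right_continuous (Z i ^~ x).
Hypothesis Z0 : forall i u x, 0 <= Z i u x.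

Let f i u x : R := Num.sqrt (Z i u x).
Arguments f : clear implicits.

Lemma measurable_sqrt_process i u : measurable_fun setT (f i u).
Proof.
have ms : measurable_fun setT (@Num.sqrt R).
  by apply: continuous_measurable_fun; apply: sqrt_continuous.
exact: (measurableT_comp ms (@Zm i u)).
Qed.

Lemma right_continuous_sqrt_process i x : right_continuous (f i ^~ x).
Proof.
by move=> u; apply: continuous_cvg; [exact: sqrt_continuous|exact: Zr].
Qed.

Let fm := measurable_sqrt_process.
Let fr := right_continuous_sqrt_process.

Variables (gamma kappa : R) (B : int -> R).
Hypothesis gamma0 : 0 < gamma.
Hypothesis kappa0 : 0 < kappa.
Hypothesis hA : forall i h l, 0 < h ->
  (P i [set x | (h `^ gamma)%:E <
      Delta_M1_on h (fun u : R => Num.sqrt (Z i u x)) l%:~R (l%:~R + 1)]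
   <= (B l * h `^ gamma)%:E)%E.
Hypothesis hB : forall i u,
  ('E_(P i)[fun x => Num.sqrt (Z i u x)] <= (expR (- (kappa * `|u|)))%:E)%E.

Let supf i (l : int) (c : R) := [set x | (c%:E <
  ereal_sup [set (f i u x)%:E | u in [set u | (l%:~R <= u <= l%:~R + 1)%R]])%E].
Let supZ i (l : int) (c : R) := [set x | (c%:E <
  ereal_sup [set (Z i u x)%:E | u in [set u | (l%:~R <= u <= l%:~R + 1)%R]])%E].
Arguments supf : clear implicits.
Arguments supZ : clear implicits.

(** The scale [h] and the level [s] stay independent: the exponential bound couples them, while the
    bound on the modulus fixes [h] and takes [s] large. *)
Lemma probability_sup_sqrt_gt i l h s : 0 < h <= 1 -> 0 < s ->
  (P i (supf i l (s + h `^ gamma)) <= (B l * h `^ gamma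
     + 3 / h * (expR kappa * expR (- (kappa * `|l%:~R|)) / s))%:E)%E.
Proof.
(* The grid has [m + 1 <= 1 / h + 2 <= 3 / h] points because [h <= 1]. *)
move=> /andP[h0 h1] s0; pose m := (Num.trunc h^-1).+1.
have mh : h^-1 < m%:R by exact: truncnS_gt.
have m0 : 0 < m%:R :> R by rewrite ltr0n.
have mh' : m%:R^-1 <= h by rewrite -[leRHS]invrK lef_pV2 ?posrE ?invr_gt0// ltW.
have f0 u x : 0 <= f i u x by exact: sqrtr_ge0.
have fE u : l%:~R <= u <= l%:~R + 1 ->
    ('E_(P i)[f i u] <= (expR kappa * expR (- (kappa * `|l%:~R|)))%:E)%E.
  move=> lu; apply: le_trans (hB i u) _; rewrite lee_fin.
  exact: expRN_norm_le.
have tail := probability_sup_gt (P := P i) (@fm i) (@fr i) f0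
  (h `^ gamma) (ltn0Sn _) mh' s0 fE.
apply: le_trans tail _.
rewrite EFinD; apply: leeD; first exact: hA.
rewrite lee_fin ler_wpM2r ?divr_ge0 ?mulr_ge0 ?expR_ge0 ?(ltW s0)//.
have hV : 1 <= h^-1 by rewrite invf_ge1.
have : (Num.trunc h^-1)%:R <= h^-1 by rewrite truncn_le invr_ge0 ltW.
by rewrite /m -!natr1; lra.
Qed.

Lemma measurable_supZ i l c : measurable (supZ i l c).
Proof.
exact: (measurable_sup_gt (@Zm i) (@Zr i) _ (@right_open_but_seg _ _ _)).
Qed.

Lemma measurable_supf i l c : measurable (supf i l c).
Proof.
exact: (measurable_sup_gt (@fm i) (@fr i) _ (@right_open_but_seg _ _ _)).
Qed.

(** * Exponential tails of the supremum *)

Lemma sup_tail_expR : poly_growth B ->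
  exists b C : R, [/\ 0 < b, 0 < C & forall i (l : int),
    (P i (supZ i l (expR (- (b * `|l%:~R|)))) <=
      (C * expR (- (b * `|l%:~R|)))%:E)%E].
Proof.
move=> [C0 [p hC0]].
(* with this choice [kappa - a - g = kappa / 2] *)
pose a := kappa / (2 * (1 + gamma)); pose g := a * gamma.
have a0 : 0 < a by rewrite divr_gt0// mulr_gt0// addr_gt0.
have g0 : 0 < g by rewrite mulr_gt0.
have ag : a + g = kappa / 2 by rewrite /g /a; field; rewrite gt_eqF// addr_gt0.
(* Half of the rate [g] is spent on absorbing the polynomial growth of [B], which leaves
   [b = g / 2]. *)
have [M M0 hM] := exprn_le_expR p (divr_gt0 g0 (ltr0n R 2)).
(* Chosen so that [h = c exp (- a |l|)] satisfies [2 h^gamma = exp (- g |l|)] exactly. *)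
pose c : R := 2^-1 `^ gamma^-1.
have c0 : 0 < c by rewrite powR_gt0.
have c1 : c <= 1.
  apply: le_trans (_ : 1 `^ gamma^-1 <= _); last by rewrite powR1.
  by rewrite ge0_ler_powR ?nnegrE ?invr_ge0 ?(ltW gamma0)//; lra.
have cg : c `^ gamma = 2^-1 by rewrite /c -powRrM mulVf ?gt_eqF// powRr1.
exists (g / 2), (`|C0| * M + 6 / c * expR kappa); split.
- exact: divr_gt0.
- apply: ltr_wpDl; rewrite ?mulr_ge0 ?(ltW M0)//.
  by rewrite mulr_gt0 ?expR_gt0// divr_gt0.
move=> i l; set X : R := `|l%:~R|.
have X0 : 0 <= X by exact: normr_ge0.
pose h := c * expR (- (a * X)).
have h0 : 0 < h by rewrite mulr_gt0 ?expR_gt0.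
have h1 : h <= 1.
  rewrite mulr_ile1 ?expR_ge0 ?(ltW c0)// -expR0 ler_expR oppr_le0.
  by rewrite mulr_ge0// ltW.
have hg : h `^ gamma = expR (- (g * X)) / 2.
  rewrite powRM ?expR_ge0 ?(ltW c0)// cg -expRM mulrC; congr (expR _ / 2).
  by rewrite /g mulNr mulrAC.
have s0 : 0 < h `^ gamma by rewrite powR_gt0.
have h01 : 0 < h <= 1 by rewrite h0.
have := @probability_sup_sqrt_gt i l h (h `^ gamma) h01 s0.
have -> : h `^ gamma + h `^ gamma = expR (- (g * X)) by rewrite hg; lra.
(* The square root of the level [exp (- g X / 2)] for Z is still at least [exp (- g X)]. *)
move=> tail; apply: (@le_trans _ _ (P i (supf i l (expR (- (g * X)))))).
  apply: le_measure; rewrite ?inE.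
  - exact: measurable_supZ.
  - exact: measurable_supf.
  move=> x /= /ereal_sup_gt[_ [u lu <-]]; rewrite lte_fin => hZ.
  apply: lt_le_trans (_ : ((f i u x)%:E <= _)%E); last first.
    by apply: ereal_sup_ubound; exists u.
  rewrite lte_fin.
  apply: (@le_lt_trans _ _ (Num.sqrt (expR (- (g / 2 * X))))); last first.
    rewrite ltr_sqrt; first exact: hZ.
    by apply: le_lt_trans hZ; exact: expR_ge0.
  rewrite -[leLHS]ger0_norm ?expR_ge0// -sqrtr_sqr ler_wsqrtr//.
  rewrite -expRM_natl ler_expR; have := mulr_ge0 (ltW g0) X0; lra.
apply: le_trans tail _; rewrite lee_fin [leRHS]mulrDl; apply: lerD.
  have BX : B l <= `|C0| * M * expR (g / 2 * X).
    apply: le_trans (ler_norm _) _; apply: le_trans (hC0 l) _.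
    rewrite -/X -mulrA; apply: le_trans (_ : `|C0| * (1 + X) ^+ p <= _).
      by rewrite ler_wpM2r ?ler_norm// exprn_ge0// addr_ge0.
    by rewrite ler_wpM2l// hM.
  apply: le_trans (_ : `|C0| * M * expR (g / 2 * X) * expR (- (g * X)) <= _).
    apply: le_trans (_ : `|C0| * M * expR (g / 2 * X) * h `^ gamma <= _).
      by rewrite ler_wpM2r ?powR_ge0//; exact: BX.
    rewrite ler_wpM2l ?mulr_ge0 ?expR_ge0 ?(ltW M0)// hg.
    have := expR_ge0 (- (g * X)); lra.
  rewrite -mulrA -expRD le_eqVlt; apply/orP; left; apply/eqP.
  by congr (_ * expR _); field.
have -> : 3 / h * (expR kappa * expR (- (kappa * X)) / h `^ gamma) =
    6 / c * expR kappa * expR (- (kappa * X) + a * X + g * X).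
  rewrite hg /h !expRD -[a * X]opprK -[g * X]opprK [expR (- - (a * X))]expRN.
  rewrite [expR (- - (g * X))]expRN !opprK; field.
  by rewrite !gt_eqF ?expR_gt0.
rewrite ler_pM2l ?mulr_gt0 ?expR_gt0 ?invr_gt0// ler_expR.
have -> : - (kappa * X) + a * X + g * X = - ((a + g) * X).
  have -> : kappa = (a + g) * 2 by rewrite ag; field.
  by field.
by rewrite lerN2 ler_wpM2r//; lra.
Qed.

Lemma sup_outside_tail (b C : R) : 0 < b -> 0 < C ->
  (forall i (l : int), (P i (supZ i l (expR (- (b * `|l%:~R|)))) <=
      (C * expR (- (b * `|l%:~R|)))%:E)%E) ->
  forall i (A : nat), (P i [set x | ((expR (- (b * A%:R)))%:E <
     ereal_sup [set (Z i u x)%:E | u in [set u : R | (A%:R < `|u|)%R]])%E]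
   <= (C *+ 2 / (1 - expR (- b)) * expR (- (b * A%:R)))%:E)%E.
Proof.
move=> b0 C0 hC i A.
pose E l := supZ i l (expR (- (b * `|l%:~R|))).
(* The two cells with [|l| = A + k]; their probabilities decay geometrically in [k] with ratio
   [exp (- b)]. *)
pose F k := E (A + k)%N%:Z `|` E (- (A + k)%N%:Z).
have mF k : measurable (F k) by apply: measurableU; exact: measurable_supZ.
set S := [set x | _].
have mS : measurable S.
  exact: (measurable_sup_gt (@Zm i) (@Zr i) _ (@right_open_but_norm_gt _ _ 0)).
have SF : S `<=` \bigcup_k F k.
  move=> x /ereal_sup_gt[_ [u /= Au <-]]; rewrite lte_fin => hu.
  pose l := Num.floor u.
  have /andP[lu ul] := floor_itv u; rewrite -/l in lu ul.
  (* As [A] is an integer, [u > A] gives [floor u >= A]; and [u < - A] gives [floor u < - A]. *)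
  have Al : (A <= `|l|)%N.
    rewrite -lez_nat abszE; have [l0|l0] := leP 0 l.
      rewrite ger0_norm// -ltzD1 -(ltr_int R); apply: le_lt_trans ul.
      have u0 : 0 <= u by apply: le_trans lu; rewrite ler0z.
      by apply: ltW; rewrite ger0_norm in Au.
    have u0 : u < 0 by apply: lt_le_trans ul _; rewrite lerz0 lezD1.
    rewrite ltr0_norm// -(ler_int R) rmorphN/=.
    by rewrite ltr0_norm// in Au; lra.
  have El : E l x.
    apply: lt_le_trans (_ : ((Z i u x)%:E <= _)%E); last first.
      by apply: ereal_sup_ubound; exists u => //=; rewrite lu/= ltW// -intrD1.
    rewrite lte_fin; apply: le_lt_trans hu; rewrite ler_expR lerN2 ler_pM2l//.
    by rewrite -intr_norm -abszE ler_nat.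
  exists (`|l| - A)%N => //; rewrite /F subnKC//.
  have [l0|l0] := leP 0 l; [left|right].
    by rewrite gez0_abs.
  by rewrite ltz0_abs// opprK.
have := @measure_sigma_subadditive _ _ _ (P i) S F mF mS SF.
move=> /le_trans; apply.
pose q := expR (- b).
have q1 : 0 < q < 1 by rewrite expR_gt0 /q -expR0 ltr_expR oppr_lt0.
have PF k : (P i (F k) <= (C *+ 2 * expR (- (b * A%:R)) * q ^+ k)%:E)%E.
  apply: le_trans (measureU2 _ _ _) _; try exact: measurable_supZ.
  apply: le_trans (leeD (hC i _) (hC i _)) _.
  rewrite -EFinD lee_fin mulrNz normrN normr_nat.
  have -> : expR (- (b * (A + k)%:R)) = expR (- (b * A%:R)) * q ^+ k.
    by rewrite natrD mulrDr opprD expRD /q -expRM_natl mulrN [k%:R * b]mulrC.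
  by rewrite -mulr2n -mulrnAl mulrA.
apply: lime_le; first by apply: is_cvg_nneseries => *.
apply: nearW => n; apply: le_trans (lee_sum _ (fun k _ => PF k)) _.
rewrite sumEFin lee_fin -mulr_sumr.
rewrite -/q [leRHS]mulrAC ler_wpM2l ?mulr_ge0 ?mulrn_wge0 ?expR_ge0 ?(ltW C0)//.
rewrite big_mkord -[leRHS]mul1r ler_pdivlMr; last lra.
have := subrX1 q n; have : 0 <= q ^+ n by rewrite exprn_ge0//; lra.
by lra.
Qed.

(** * Smallness of the M1 modulus in probability *)

Lemma Delta_M1_tail (b C : R) : 0 < b -> 0 < C ->
  (forall i (A : nat), (P i [set x | ((expR (- (b * A%:R)))%:E <
     ereal_sup [set (Z i u x)%:E | u in [set u : R | (A%:R < `|u|)%R]])%E]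
   <= (C * expR (- (b * A%:R)))%:E)%E) ->
  forall e eta : R, 0 < e -> 0 < eta ->
  exists2 h0, 0 < h0 & forall h i, 0 < h <= h0 ->
    (P i [set x | (e%:E < Delta_M1 h (fun u => Z i u x))%E] <= eta%:E)%E.
Proof.
move=> b0 C0 hC e eta e0 eta0.
(* Constants are chosen in the order [A], [h1], [s], [M], [h2]. The budget [eta] is split in thirds:
   the tail beyond [A], the oscillation events, and the Markov terms. *)
pose r := Num.min 1 (e / 2).
have r0 : 0 < r by rewrite lt_min ltr01 divr_gt0.
have rC : 0 < Num.min r (eta / (3 * C)).
  by rewrite lt_min r0 divr_gt0// mulr_gt0.
have [A] := expRN_le_near_infty b0 rC; rewrite le_min => /andP[Ar AC].
(* The cells start at the integers from [- (A + 1)] to [A + 1]; the last one is there because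
   [floor u] reaches [A + 1] at [u = A + 1]. *)
pose N := (2 * A + 3)%N; pose lk (k : nat) : int := k%:Z - A.+1%:Z.
pose S := \sum_(k < N) `|B (lk k)| + 1.
have S0 : 0 < S by rewrite ltr_wpDl// sumr_ge0.
have [h1 [h10 h11 hh1]] := powR_le_near0 gamma0
  (divr_gt0 eta0 (mulr_gt0 (ltr0n R 6) S0)).
have {}hh1 : h1 `^ gamma <= eta / (6 * S) by apply: hh1; rewrite h10 lexx.
(* [W / s] bounds the Markov term of one cell at the fixed scale [h1], and [s] makes
   [N W / s <= eta / 3]. The added 1 ensures [M >= 1]. *)
pose W := 3 / h1 * expR kappa; pose s := N%:R * W * 6 / eta + 1.
have W0 : 0 < W by rewrite mulr_gt0 ?expR_gt0// divr_gt0.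
have s1 : 1 <= s.
  by rewrite lerDr divr_ge0 ?(ltW eta0)// mulr_ge0// mulr_ge0// ltW.
have s0 : 0 < s by apply: lt_le_trans s1.
pose M := s + h1 `^ gamma.
have M1 : 1 <= M by rewrite (le_trans s1)// lerDl powR_ge0.
have M0 : 0 < M by apply: lt_le_trans M1.
(* Only now is the small scale chosen: [M] depends on [h1] but not on [h], so [2 M h^gamma <= r] can
   be achieved. *)
have [|h2 [h20 h21 hh2]] := @powR_le_near0 _ gamma
    (Num.min (eta / (6 * S)) (r / (M *+ 2))) gamma0.
  by rewrite lt_min !divr_gt0// ?mulr_gt0// mulrn_wgt0.
have A1 : 0 < A%:R + 1 :> R by rewrite ltr_wpDl.
exists (Num.min h2 (A%:R + 1)^-1); first by rewrite lt_min h20 invr_gt0.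
move=> h i; rewrite le_min => /and3P[h0 hh hA1].
have h1' : h <= 1 by apply: le_trans hh h21.
have Ah : A%:R <= 1 / h.
  rewrite div1r; apply: (@le_trans _ _ (A%:R + 1)); first by rewrite lerDl.
  by rewrite -[leLHS]invrK lef_pV2 ?posrE ?invr_gt0.
have : h `^ gamma <= Num.min (eta / (6 * S)) (r / (M *+ 2)).
  by apply: hh2; rewrite h0.
rewrite le_min => /andP[hS hM].
set E := (X in (P i X <= _)%E).
pose G := [set x | ((expR (- (b * A%:R)))%:E <
     ereal_sup [set (Z i u x)%:E | u in [set u : R | (A%:R < `|u|)%R]])%E].
pose O k := [set x | ((h `^ gamma)%:E < Delta_M1_on h (fun u : R => f i u x)
   (lk k)%:~R ((lk k)%:~R + 1))%E].
pose F k := supf i (lk k) M `|` O k.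
have mE : measurable E.
  by apply: (measurable_Delta_M1_gt (@Zm i) (@Zr i)) => // ? ?; exact: Z0.
have mG : measurable G.
  exact: (measurable_sup_gt (@Zm i) (@Zr i) _ (@right_open_but_norm_gt _ _ 0)).
have mO k : measurable (O k).
  exact: (measurable_M1_osc_gt (@fm i) (@fr i) _ h0
    (@right_open_but_seg _ _ _)).
have mF k : measurable (F k).
  by apply: measurableU => //; exact: measurable_supf.
have mU : measurable (\big[setU/set0]_(k < N) F k) by exact: bigsetU_measurable.
have EGF : E `<=` G `|` \big[setU/set0]_(k < N) F k.
  move=> x Ex; apply: contrapT => /not_orP[Gx Fx]; move: Ex.
  apply/negP; rewrite -leNgt.
  have cell (u : R) : `|u| <= A%:R + 1 ->
      exists2 k, ~ F k x & (lk k)%:~R <= u <= (lk k)%:~R + 1.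
    rewrite ler_norml => /andP[Au uA].
    have SA : A.+1%:Z%:~R = A%:R + 1 :> R by rewrite natr1.
    have Am : - (A.+1)%:Z <= Num.floor u.
      by rewrite floor_ge_int rmorphN/= SA.
    have mA : Num.floor u <= A.+1%:Z.
      rewrite -(ler_int R); apply: le_trans (floor_le u) _.
      by rewrite SA.
    pose k := absz (Num.floor u + A.+1%:Z).
    have kE : k%:Z = Num.floor u + A.+1%:Z.
      by rewrite gez0_abs// -lerBlDr sub0r.
    exists k.
      move=> Fk; apply: Fx; rewrite -bigcup_mkord; exists k => //=.
      rewrite -ltz_nat kE; apply: (@le_lt_trans _ _ (A.+1%:Z + A.+1%:Z)).
        by rewrite lerD2r.
      by rewrite -PoszD ltz_nat /N mul2n -addnn addnS addSn addn3.
    rewrite /lk kE addrK.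
    by have /andP[-> /ltW] := floor_itv u; rewrite intrD.
  apply: (@le_trans _ _ (r *+ 2)%:E); last first.
    rewrite lee_fin -mulr_natr -ler_pdivlMr//.
    by rewrite ge_min lexx orbT.
  apply: (@Delta_M1_le_sqrt _ _ _ _ M (h `^ gamma) A) => //.
  - by rewrite (ltW r0) /= ge_min lexx.
  - by rewrite -ler_pdivlMl ?mulrn_wgt0// mulrC.
  - move=> u uA; apply: le_trans Ar; rewrite leNgt; apply/negP => hu.
    apply: Gx; apply: lt_le_trans (_ : ((Z i u x)%:E <= _)%E); last first.
      by apply: ereal_sup_ubound; exists u.
    by rewrite lte_fin.
  - move=> u /cell[k /not_orP[Fk _] lu]; rewrite leNgt; apply/negP => hu.
    apply: Fk; apply: lt_le_trans (_ : ((f i u x)%:E <= _)%E); last first.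
      by apply: ereal_sup_ubound; exists u.
    by rewrite lte_fin.
  - move=> u u' u'' /cell[k /not_orP[_ /negP Ok] lu] h3 h4.
    rewrite -lee_fin; rewrite -leNgt in Ok; apply: le_trans Ok.
    exact: (M1_osc_ge (fun u => f i u x)).
apply: le_trans (le_measure (P i) _ _ EGF) _; rewrite ?inE//.
  exact: measurableU.
apply: le_trans (measureU2 _ mG mU) _.
have -> : eta = eta / 3 + eta * 2 / 3 by field.
rewrite EFinD; apply: leeD.
  apply: le_trans (hC i A) _; rewrite lee_fin.
  have -> : eta / 3 = C * (eta / (3 * C)) by field; rewrite gt_eqF.
  by rewrite ler_pM2l.
have := @content_subadditive _ _ _ (P i) _ F N (fun k _ => mF k) mU.
move=> /(_ (@subset_refl _ _)) /le_trans; apply.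
(* Hypothesis (A) is used twice, at scale [h1] for the supremum and at scale [h] for the
   oscillation, each time at cost [|B| eta / (6 S)]. *)
have PF k : (P i (F k) <= (`|B (lk k)| * (eta / (3 * S)) + W / s)%:E)%E.
  apply: le_trans (measureU2 _ (measurable_supf _ _ _) (mO k)) _.
  have h11' : 0 < h1 <= 1 by rewrite h10.
  apply: le_trans
    (leeD (probability_sup_sqrt_gt i (lk k) h11' s0) (hA i _ h0)) _.
  rewrite -EFinD lee_fin.
  have BS y : 0 <= y -> y <= eta / (6 * S) ->
      B (lk k) * y <= `|B (lk k)| * (eta / (6 * S)).
    move=> y0 yS; apply: (@le_trans _ _ (`|B (lk k)| * y)).
      by rewrite ler_wpM2r// ler_norm.
    by rewrite ler_wpM2l.
  have -> : eta / (3 * S) = eta / (6 * S) + eta / (6 * S).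
    by field; rewrite gt_eqF.
  rewrite mulrDr addrAC; apply: lerD.
    by apply: lerD; apply: BS; rewrite ?powR_ge0.
  rewrite !mulrA ler_wpM2r ?invr_ge0 ?(ltW s0)// -/W ler_piMr ?(ltW W0)//.
  by rewrite -expR0 ler_expR oppr_le0 mulr_ge0// ltW.
apply: (@le_trans _ _
    (\sum_(k < N) (`|B (lk k)| * (eta / (3 * S)) + W / s)%:E)%E).
  by apply: lee_sum => k _; exact: PF.
rewrite sumEFin lee_fin big_split/= -mulr_suml sumr_const card_ord.
apply: (@le_trans _ _ (eta / 3 + eta / 3)); last lra.
apply: lerD.
  have -> : eta / 3 = S * (eta / (3 * S)) by field; rewrite gt_eqF.
  by rewrite ler_wpM2r ?lerDl// divr_ge0 ?mulr_ge0// ltW.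
rewrite -[W / s *+ N]mulr_natl mulrA ler_pdivrMr//.
have -> : eta / 3 * s = N%:R * W * 2 + eta / 3.
  by rewrite /s; field; rewrite gt_eqF.
have := mulr_ge0 (ler0n R N) (ltW W0); lra.
Qed.

End UniformFamily.

(** * Assembly: uniformity in the parameter and the limit in [h] *)

Theorem theorem10 (R : realType) (alpha beta : \bar R)
  (d : nat -> measure_display) (T : forall n : nat, measurableType (d n))
  (nu : forall n : nat, {measure set (T n) -> \bar R})
  (P : forall n : nat, R -> probability (T n) R)
  (L : forall n : nat, R -> T n -> R)
  (phi : nat -> R)
  (Z : forall n : nat, R -> R -> T n -> R)
  (K : set R)
  (hL : forall (n : nat) (theta : R), (0 < n)%N ->
    param_space alpha beta theta ->
    is_likelihood (nu n) (P n theta) (L n theta))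
  (phi_gt0 : forall n : nat, (0 < n)%N -> 0 < phi n)
  (phi_decr : forall m n : nat, (0 < m)%N -> (m <= n)%N -> phi n <= phi m)
  (phi_cvg : phi n @[n --> \oo] --> (0 : R))
  (hZ : forall (n : nat) (theta : R), (0 < n)%N ->
    param_space alpha beta theta ->
    normalized_LR alpha beta (L n) (phi n) theta (Z n theta))
  (K_sub : K `<=` param_space alpha beta)
  (K_compact : compact K)
  (hA : exists (gamma : R) (B : int -> R),
    [/\ 0 < gamma, poly_growth B &
      forall (h : R) (n : nat) (l : int) (theta : R),
        0 < h -> (0 < n)%N -> K theta ->
        (P n theta [set x | (h `^ gamma)%:E <
             Delta_M1_on h (fun u : R => Num.sqrt (Z n theta u x))
               l%:~R (l%:~R + 1)]
         <= (B l * h `^ gamma)%:E)%E])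
  (hB : exists kappa : R, 0 < kappa /\
    forall (n : nat) (u theta : R), (0 < n)%N -> K theta ->
      ('E_(P n theta)[fun x : T n => Num.sqrt (Z n theta u x)]
       <= (expR (- (kappa * `|u|)))%:E)%E) :
  [/\ (exists b C : R, [/\ 0 < b, 0 < C &
        forall (n : nat) (l : int) (theta : R), (0 < n)%N -> K theta ->
          (P n theta [set x | (expR (- (b * `|l%:~R|)))%:E <
               ereal_sup [set (Z n theta u x)%:E |
                 u in [set u : R | (l%:~R <= u <= l%:~R + 1)%R]]]
           <= (C * expR (- (b * `|l%:~R|)))%:E)%E]),
      (exists b C : R, [/\ 0 < b, 0 < C &
        forall (n A : nat) (theta : R), (0 < n)%N -> K theta ->
          (P n theta [set x | (expR (- (b * A%:R)))%:E <
               ereal_sup [set (Z n theta u x)%:E |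
                 u in [set u : R | (A%:R < `|u|)%R]]]
           <= (C * expR (- (b * A%:R)))%:E)%E]) &
      (* the real [sup] of the empty set is 0, which covers K = set0 *)
      (forall eps : R, 0 < eps ->
        limn_esup (fun n : nat =>
          (sup [set fine (P n theta [set x | (eps%:E <
                     Delta_M1 h (fun u : R => Z n theta u x))%E])
               | theta in K])%:E)
        @[h --> (0 : R)^'+] --> (0 : \bar R))].
Proof.
have [gamma [B [gamma0 Bg hAg]]] := hA.
have [kappa [kappa0 hBk]] := hB.
(* Taking the admissible pairs (n, theta) as indices makes all constants obtained for the family
   uniform in both. *)
pose I := {p : nat * R | (0 < p.1)%N /\ K p.2}.
pose idx n theta (n0 : (0 < n)%N) (Kt : K theta) : I :=
  exist _ (n, theta) (conj n0 Kt).
pose ZI (i : I) := Z (sval i).1 (sval i).2.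
have ZP (i : I) : normalized_LR alpha beta (L (sval i).1) (phi (sval i).1)
    (sval i).2 (ZI i).
  by case: i => -[n theta] /= [n0 Kt]; apply: hZ => //; exact: K_sub.
have Zm (i : I) u : measurable_fun setT (ZI i u) by case: (ZP i).
have Zr (i : I) x : right_continuous ((ZI i) ^~ x).
  by case: (ZP i) => _ _ _ /(_ x) [cad _ _] u; have [] := cad u.
have Z0 (i : I) u x : 0 <= ZI i u x by case: (ZP i).
pose PI (i : I) := P (sval i).1 (sval i).2.
have hAI (i : I) h l : 0 < h ->
    (PI i [set x | (h `^ gamma)%:E <
       Delta_M1_on h (fun u : R => Num.sqrt (ZI i u x)) l%:~R (l%:~R + 1)]
     <= (B l * h `^ gamma)%:E)%E.
  by case: i => -[n theta] [n0 Kt] h0; exact: hAg.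
have hBI (i : I) u : ('E_(PI i)[fun x => Num.sqrt (ZI i u x)]
    <= (expR (- (kappa * `|u|)))%:E)%E.
  by case: i => -[n theta] [n0 Kt]; exact: hBk.
have [b [C [b0 C0 hi]]] := sup_tail_expR Zm Zr gamma0 kappa0 hAI hBI Bg.
have hii := sup_outside_tail Zm Zr b0 C0 hi.
pose C' := C *+ 2 / (1 - expR (- b)).
have C'0 : 0 < C'.
  by rewrite divr_gt0 ?mulrn_wgt0// subr_gt0 -expR0 ltr_expR oppr_lt0.
split.
- exists b, C; split => // n l theta n0 Kt; exact: (hi (idx n theta n0 Kt)).
- exists b, C'; split => // n A theta n0 Kt; exact: (hii (idx n theta n0 Kt)).
move=> e e0.
pose q h n theta := P n theta
  [set x | (e%:E < Delta_M1 h (fun u => Z n theta u x))%E].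
(* Thus [fine] loses nothing and the real [sup] over [K] is that of a bounded set. *)
have q01 h n theta : 0 < h -> (0 < n)%N -> K theta -> (0 <= q h n theta <= 1)%E.
  move=> h0 n0 Kt; rewrite measure_ge0/= probability_le1//.
  exact: (measurable_Delta_M1_gt (@Zm (idx n theta n0 Kt))
    (@Zr (idx n theta n0 Kt))).
pose s h n := sup [set fine (q h n theta) | theta in K].
have s_ge0 h n : 0 < h -> (0 < n)%N -> 0 <= s h n.
  rewrite /s => h0 n0; have [->|/set0P[t Kt]] := eqVneq K set0.
    by rewrite image_set0 sup0.
  apply: le_trans (_ : fine (q h n t) <= _); first by rewrite fine_ge0.
  apply: ub_le_sup; last by exists t.
  exists 1 => _ [t' Kt' <-]; have /andP[q0 q1] := q01 h n t' h0 n0 Kt'.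
  by rewrite -lee_fin fineK ?ge0_fin_numE// (le_lt_trans q1)// ltry.
have s_le h n eta : 0 <= eta -> 0 < h -> (0 < n)%N ->
    (forall t, K t -> (q h n t <= eta%:E)%E) -> s h n <= eta.
  rewrite /s => eta0 h0 n0 qe; have [->|/set0P[t Kt]] := eqVneq K set0.
    by rewrite image_set0 sup0.
  apply: ge_sup; first by exists (fine (q h n t)), t.
  move=> _ [t' Kt' <-]; have /andP[q0 q1] := q01 h n t' h0 n0 Kt'.
  by rewrite -lee_fin fineK ?qe// ge0_fin_numE// (le_lt_trans q1)// ltry.
have lim_ge0 h : 0 < h -> (0 <= limn_esup (fun n => (s h n)%:E))%E.
  move=> h0; apply: le_ereal_inf_tmp => _ [V [N _ NV] <-].
  (* The index [N.+1] is positive even for [N = 0], and the hypotheses concern positive [n] only. *)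
  apply: le_trans (_ : ((s h N.+1)%:E <= _)%E); first by rewrite lee_fin s_ge0.
  by apply: ereal_sup_ubound; exists N.+1 => //; apply: NV => /=.
have lim_le h eta : 0 < h -> (forall n, (0 < n)%N -> s h n <= eta) ->
    (limn_esup (fun n => (s h n)%:E) <= eta%:E)%E.
  move=> h0 se; apply: (@le_trans _ _
    (ereal_sup [set (s h n)%:E | n in [set n | (0 < n)%N]])).
    by apply: ereal_inf_lbound; exists [set n | (0 < n)%N] => //; exists 1%N.
  by apply: ge_ereal_sup => _ [n n0 <-]; rewrite lee_fin se.
have small eta : 0 < eta -> \forall h \near (0 : R)^'+,
    (0 <= limn_esup (fun n => (s h n)%:E) <= eta%:E)%E.
  move=> eta0.
  have [h0 h00 hh0] :=
    Delta_M1_tail Zm Zr Z0 gamma0 kappa0 hAI hBI b0 C'0 hii e0 eta0.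
  near=> h.
  have hp : 0 < h by near: h; exact: nbhs_right_gt.
  have hle : h <= h0 by near: h; exact: nbhs_right_le.
  rewrite lim_ge0//= lim_le// => n n0; apply: s_le => // [|t Kt].
    exact: ltW.
  by apply: (hh0 h (idx n t n0 Kt)); rewrite hp.
(* Convergence in the extended reals is reduced to real convergence, which requires the upper limit
   to be finite for small [h]. *)
have fin : \forall h \near (0 : R)^'+,
    limn_esup (fun n => (s h n)%:E) \is a fin_num.
  near=> h.
  have /andP[l0 l1] : (0 <= limn_esup (fun n => (s h n)%:E) <= 1%:E)%E.
    by near: h; exact: small.
  by rewrite ge0_fin_numE// (le_lt_trans l1)// ltry.
apply/fine_cvgP; split => //; apply/cvgrPdist_le => eta eta0.
near=> h.
have /andP[l0 l1] : (0 <= limn_esup (fun n => (s h n)%:E) <= eta%:E)%E.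
  by near: h; exact: small.
rewrite /= sub0r normrN ger0_norm ?fine_ge0//.
by rewrite -lee_fin fineK//; near: h.
Unshelve. all: by end_near. Qed.
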